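(* Let $k\ge1$. For every $(x,y,z)\in\mathcal{F}_k({\sf V})$ we have $w^{k+2}(x,y,z)=(z,y,x)$.
   Context: ${\sf V}$ is the poset with elements $c,\ell,r$ and relations $c<\ell$, $c<r$. $\mathcal{F}_k({\sf V})$ is the set of functions $f:{\sf V}\to\{0,\dots,k\}$ with $f(\ell)\le f(c)$ and $f(r)\le f(c)$, written as triples $(f(\ell),f(c),f(r))$. For $x\in{\sf V}$, the whirl $w_x$ repeatedly adds $1$ modulo $k+1$ to $f(x)$ (other values unchanged) until the result lies in $\mathcal{F}_k({\sf V})$. Whirling is $w=w_c\circ w_r\circ w_\ell$ (apply $w_\ell$, then $w_r$, then $w_c$). *)

(* Defs.v *)
From HB Require Import structures.
From mathcomp Require Import all_boot all_order.

Set Implicit Arguments.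
Unset Strict Implicit.
Unset Printing Implicit Defensive.

Import Order.TTheory.

Inductive V : Type := Vl | Vc | Vr.

Definition V_ord (v : V) : 'I_3 :=
  match v with Vl => inord 0 | Vc => inord 1 | Vr => inord 2 end.

Definition ord_V (i : 'I_3) : V :=
  match val i with 0 => Vl | 1 => Vc | _ => Vr end.

Lemma V_ordK : cancel V_ord ord_V.
Proof. by case; rewrite /ord_V /= inordK. Qed.

HB.instance Definition _ := Countable.copy V (can_type V_ordK).
HB.instance Definition _ : isFinite V := CanIsFinite V_ordK.

Definition leV (u v : V) : bool := (u == v) || (u == Vc).

Lemma leV_refl : reflexive leV.
Proof. by move=> u; rewrite /leV eqxx. Qed.

Lemma leV_anti : antisymmetric leV.
Proof.
move=> u v /andP[/orP[/eqP //|/eqP ->]] /orP[/eqP //|/eqP -> //].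
Qed.

Lemma leV_trans : transitive leV.
Proof.
move=> v u w /orP[/eqP -> //|/eqP ->] _; by rewrite /leV eqxx orbT.
Qed.

Fact V_display : Order.disp_t. Proof. exact: Order.Disp tt tt. Qed.

HB.instance Definition _ :=
  Order.Le_isPOrder.Build V_display V leV_refl leV_anti leV_trans.

Definition in_F (k : nat) (f : {ffun V -> 'I_k.+1}) : bool :=
  (f Vl <= f Vc) && (f Vr <= f Vc).

Lemma in_FP (k : nat) (f : {ffun V -> 'I_k.+1}) :
  reflect (forall u v : V, (u <= v)%O -> f v <= f u) (in_F f).
Proof.
apply: (iffP andP) => [[fl fr] u v|fV].
  by move=> /orP[/eqP -> //|/eqP ->]; case: v.
by split; apply: fV; rewrite /Order.le /= /leV eqxx orbT.
Qed.

Definition F (k : nat) : Type := {f : {ffun V -> 'I_k.+1} | in_F f}.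

Definition triple (k : nat) (x y z : 'I_k.+1) : {ffun V -> 'I_k.+1} :=
  [ffun v => match v with Vl => x | Vc => y | Vr => z end].

(* [ordS] is the cyclic successor, i.e. adding 1 modulo k + 1. *)
Definition incr (k : nat) (x : V) (f : {ffun V -> 'I_k.+1}) :
    {ffun V -> 'I_k.+1} :=
  [ffun v => if v == x then ordS (f v) else f v].

Lemma iter_incrE (k n : nat) (x v : V) (f : {ffun V -> 'I_k.+1}) :
  iter n (incr x) f v = if v == x then iter n (@ordS k.+1) (f v) else f v.
Proof.
elim: n => [|n IHn] /=; first by case: (v == x).
by rewrite ffunE IHn; case: (v == x).
Qed.

Lemma val_iter_ordS (k n : nat) (i : 'I_k.+1) :
  val (iter n (@ordS k.+1) i) = (i + n) %% k.+1.
Proof.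
elim: n => [|n IHn] /=; first by rewrite addn0 modn_small.
by rewrite -/(val (iter _ _ _)) IHn -addn1 modnDml addn1 addnS.
Qed.

Lemma whirl_ex (k : nat) (x : V) (f : F k) :
  exists n, (0 < n) && in_F (iter n (incr x) (val f)).
Proof.
exists k.+1; suff -> : iter k.+1 (incr x) (val f) = val f by rewrite (valP f).
apply/ffunP => v; rewrite iter_incrE; case: ifP => // _.
by apply: val_inj; rewrite val_iter_ordS modnDr modn_small.
Qed.

(* 1 is added at least once, so the number of steps is the least positive n
   for which the result lies in F k. *)
Definition whirl_steps (k : nat) (x : V) (f : F k) : nat :=
  ex_minn (whirl_ex x f).

Lemma whirl_in_F (k : nat) (x : V) (f : F k) :
  in_F (iter (whirl_steps x f) (incr x) (val f)).
Proof. by rewrite /whirl_steps; case: ex_minnP => n /andP[]. Qed.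

Definition whirl (k : nat) (x : V) (f : F k) : F k :=
  exist _ (iter (whirl_steps x f) (incr x) (val f)) (whirl_in_F x f).

Definition whirling (k : nat) (f : F k) : F k :=
  whirl Vc (whirl Vr (whirl Vl f)).

(* Main.v *)
(** On triples of natural numbers, whirling increments each leaf value, or resets
    it to 0 if it equals the centre value, and then increments the centre value,
    or, if that equals [k], replaces it by the larger leaf value.  This map
    commutes with swapping the leaves, so one may assume that the left value is at
    least the right one.  The first [k + 2] iterates then have an explicit
    piecewise linear form, which depends only on which of the three values
    coincide. *)

Require Import Defs.
From mathcomp Require Import all_boot all_order.
From mathcomp Require Import zify.

Lemma eqVE : ((Vl == Vc) = false) * ((Vl == Vr) = false) * ((Vc == Vl) = false) *
  ((Vc == Vr) = false) * ((Vr == Vl) = false) * ((Vr == Vc) = false).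
Proof. by do !split; apply/eqP. Qed.

(** Replaces [ex_minn] by a certificate, so that a closed form of a whirl only needs a candidate
    step count [n] and its minimality. *)
Lemma val_whirlE (k n : nat) (v : V) (f : F k) :
    0 < n -> in_F (iter n (incr v) (val f)) ->
    (forall m, 0 < m < n -> ~~ in_F (iter m (incr v) (val f))) ->
  forall u, val (val (whirl v f) u) =
    if u == v then (val f u + n) %% k.+1 else val f u.
Proof.
move=> n_gt0 Fn Fmin u.
suff -> : val (whirl v f) = iter n (incr v) (val f).
  by rewrite iter_incrE; case: ifP => // _; rewrite val_iter_ordS.
rewrite /= /whirl_steps; case: ex_minnP => m /andP[m_gt0 Fm] /(_ n).
rewrite n_gt0 Fn => /(_ isT); rewrite leq_eqVlt => /predU1P[-> //|lt_mn].
by have := Fmin m; rewrite m_gt0 lt_mn Fm => /(_ isT).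
Qed.

Lemma in_F_iter_incr (k n : nat) (v : V) (f : {ffun V -> 'I_k.+1}) :
  let g u := if u == v then (f u + n) %% k.+1 else f u in
  in_F (iter n (incr v) f) = (g Vl <= g Vc) && (g Vr <= g Vc).
Proof.
have gE u : val (iter n (incr v) f u) =
    if u == v then (f u + n) %% k.+1 else f u.
  by rewrite iter_incrE; case: ifP => // _; rewrite val_iter_ordS.
by rewrite /in_F -!gE.
Qed.

Definition leaf_step (y x : nat) : nat := if x < y then x.+1 else 0.

Definition center_step (k y m : nat) : nat := if y < k then y.+1 else m.

Lemma whirl_leaf (k : nat) (v : V) (f : F k) : v != Vc -> forall u,
  val (val (whirl v f) u) =
    if u == v then leaf_step (val f Vc) (val f v) else val f u.
Proof.
move=> vNc; have /andP[le_l le_r] := valP f.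
have le_v : val f v <= val f Vc by case: (v) vNc => //; rewrite eqxx.
have lt_c := ltn_ord (val f Vc).
have le_F n : in_F (iter n (incr v) (val f)) =
    ((val f v + n) %% k.+1 <= val f Vc).
  rewrite in_F_iter_incr /=; case: (v) vNc => [_|/eqP//|_]; rewrite ?eqxx ?eqVE //=.
    by rewrite le_r andbT.
  by rewrite le_l.
(* A leaf equal to the centre runs through the values above it up to [k], all inadmissible, and
   stops on wrapping to 0. *)
pose n := if val f v < val f Vc then 1 else k.+1 - val f Vc.
have nE : (val f v + n) %% k.+1 = leaf_step (val f Vc) (val f v).
  rewrite /n /leaf_step; case: ifP => lt_vc.
    by rewrite addn1 modn_small //; lia.
  have -> : val f v + (k.+1 - val f Vc) = k.+1 by lia.
  exact: modnn.
move=> u; rewrite (@val_whirlE k n) ?le_F ?nE.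
- by case: eqP => // ->; rewrite nE.
- by rewrite /n; case: ifP => _; lia.
- by rewrite /leaf_step; case: ifP.
move=> m; rewrite /n le_F; case: ifP => lt_vc m_range; first lia.
by rewrite modn_small; lia.
Qed.

Lemma whirl_center (k : nat) (f : F k) u :
  val (val (whirl Vc f) u) =
    if u == Vc then center_step k (val f Vc) (maxn (val f Vl) (val f Vr))
    else val f u.
Proof.
have /andP[le_l le_r] := valP f.
have lt_c := ltn_ord (val f Vc).
set m := maxn _ _.
have le_F n : in_F (iter n (incr Vc) (val f)) =
    (m <= (val f Vc + n) %% k.+1).
  by rewrite in_F_iter_incr /= eqxx !eqVE geq_max.
(* From [k], one addition wraps to 0 and [m] more reach the least admissible centre value. *)
pose n := if val f Vc < k then 1 else m.+1.
have le_m : m <= val f Vc by rewrite geq_max le_l.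
have nE : (val f Vc + n) %% k.+1 = center_step k (val f Vc) m.
  rewrite /n /center_step; case: ifP => lt_ck.
    by rewrite addn1 modn_small //; lia.
  have -> : val f Vc + m.+1 = m + k.+1 by lia.
  by rewrite modnDr modn_small //; lia.
rewrite (@val_whirlE k n) ?le_F ?nE.
- by case: eqP => // ->; rewrite nE.
- by rewrite /n; case: ifP.
- by rewrite /center_step; case: ifP; lia.
move=> j; rewrite /n le_F; case: ifP => lt_ck j_range; first lia.
have -> : val f Vc + j = j.-1 + k.+1 by lia.
by rewrite modnDr modn_small; lia.
Qed.

(** Triples list the values at [Vl], [Vc] and [Vr], in this order. *)
Definition whirling_nat (k : nat) (s : nat * nat * nat) : nat * nat * nat :=
  let: (x, y, z) := s in
  let x' := leaf_step y x in let z' := leaf_step y z in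
  (x', center_step k y (maxn x' z'), z').

Definition nat_triple {k : nat} (f : {ffun V -> 'I_k.+1}) : nat * nat * nat :=
  (val (f Vl), val (f Vc), val (f Vr)).

Lemma nat_triple_inj (k : nat) : injective (@nat_triple k).
Proof.
by move=> f g [fl fc fr]; apply/ffunP => -[]; apply: val_inj.
Qed.

(** Both leaves are compared with the old centre value, while the centre step sees the new
    leaves. *)
Lemma nat_triple_whirling (k : nat) (f : F k) :
  nat_triple (val (whirling f)) = whirling_nat k (nat_triple (val f)).
Proof.
rewrite /nat_triple /whirling.
have := @whirl_leaf k Vl f; move: (whirl Vl f) => g.
rewrite eqVE => /(_ isT) gE.
have := @whirl_leaf k Vr g; move: (whirl Vr g) => h.
rewrite eqVE => /(_ isT) hE.
have := whirl_center k h; move: (whirl Vc h) => h' h'E.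
by rewrite !(h'E, hE, gE, eqxx, eqVE).
Qed.

Lemma nat_triple_iter_whirling (k n : nat) (f : F k) :
  nat_triple (val (iter n (@whirling k) f)) =
  iter n (whirling_nat k) (nat_triple (val f)).
Proof.
by elim: n => //= n IHn; rewrite nat_triple_whirling IHn.
Qed.

Definition swap_leaves (s : nat * nat * nat) : nat * nat * nat :=
  let: (x, y, z) := s in (z, y, x).

Lemma iter_whirling_nat_swap (k n : nat) s :
  iter n (whirling_nat k) (swap_leaves s) =
  swap_leaves (iter n (whirling_nat k) s).
Proof.
elim: n => //= n ->; case: (iter _ _ _) => -[x y] z /=.
by rewrite maxnC.
Qed.

Lemma triple_eq (T : Type) (a b c a' b' c' : T) :
  a = a' -> b = b' -> c = c' -> (a, b, c) = (a', b', c').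
Proof. by move=> -> -> ->. Qed.

(** Reduces a guessed closed form to its two ends and a single step, all within reach of [lia]. *)
Lemma iter_whirling_nat_trajectory (k N : nat) (X Y Z : nat -> nat) s s' :
    (X 0, Y 0, Z 0) = s -> (X N, Y N, Z N) = s' ->
    (forall t, t < N ->
      whirling_nat k (X t, Y t, Z t) = (X t.+1, Y t.+1, Z t.+1)) ->
  iter N (whirling_nat k) s = s'.
Proof.
move=> <- <- stepE; have: N <= N by [].
(* The right-hand [N] of [N <= N] stays fixed, as the bound required by [stepE]. *)
elim: {1 3 4 5 6}N => //= t IHt lt_tN.
by rewrite IHt ?stepE // ltnW.
Qed.

(** Innermost conditions come first, because [lia] does not read conditionals. *)
Ltac split_ifs :=
  repeat match goal with |- context [if ?b then _ else _] =>
    lazymatch b with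
    | context [if _ then _ else _] => fail
    | _ => case: (boolP b) => ?; try (exfalso; lia)
    end
  end.

Ltac check_trajectory X Y Z :=
  apply: (@iter_whirling_nat_trajectory _ _ X Y Z) => [||t lt_t];
  rewrite /whirling_nat /leaf_step /center_step;
  apply: triple_eq; rewrite /X /Y /Z; split_ifs; lia.

Lemma iter_whirling_nat_lt_lt (k x y z : nat) : z < x -> x < y -> y <= k ->
  iter k.+2 (whirling_nat k) (x, y, z) = (z, y, x).
Proof.
move=> lt_zx lt_xy le_yk.
(* The centre reaches [k] at times [k - y], [k - x] and [k - z], and one step later drops to the
   left, right and left leaf in turn; that leaf is reset at the step after. *)
pose X t := if t <= k - y + 1 then x + t
            else if t <= k - z + 1 then t - (k - y + 2) else t - (k - z + 2).
pose Y t := if t <= k - y then y + t else if t <= k - x then x + t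
            else if t <= k - z then z + t else t - (k - y + 2).
pose Z t := if t <= k - x + 1 then z + t else t - (k - x + 2).
check_trajectory X Y Z.
Qed.

Lemma iter_whirling_nat_eq_lt (k x y : nat) : x < y -> y <= k ->
  iter k.+2 (whirling_nat k) (x, y, x) = (x, y, x).
Proof.
move=> lt_xy le_yk.
(* Equal leaves move together, so the centre drops only twice, each time onto both. *)
pose X t := if t <= k - y + 1 then x + t
            else if t <= k - x + 1 then t - (k - y + 2) else t - (k - x + 2).
pose Y t := if t <= k - y then y + t else if t <= k - x then x + t
            else t - (k - y + 2).
check_trajectory X Y X.
Qed.

Lemma iter_whirling_nat_lt_eq (k y z : nat) : z < y -> y <= k ->
  iter k.+2 (whirling_nat k) (y, y, z) = (z, y, y).
Proof.
move=> lt_zy le_yk.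
(* The left leaf is reset at step 1. The centre is at [k] again at time [k.+1], so its third drop is
   the final step. *)
pose X t := if t == 0 then y
            else if t <= k - z + 1 then t - 1 else t - (k - z + 2).
pose Y t := if t <= k - y then y + t else if t <= k - z then z + t
            else if t <= k.+1 then t - 1 else y.
pose Z t := if t <= k - y + 1 then z + t else t - (k - y + 2).
check_trajectory X Y Z.
Qed.

Lemma iter_whirling_nat_eq_eq (k y : nat) : y <= k ->
  iter k.+2 (whirling_nat k) (y, y, y) = (y, y, y).
Proof.
move=> le_yk.
(* Both leaves are reset at step 1; the second and last drop of the centre is the final step and
   lands on [y]. *)
pose X t := if t == 0 then y
            else if t <= k - y + 1 then t - 1 else t - (k - y + 2).
pose Y t := if t <= k - y then y + t else if t <= k.+1 then t - 1 else y.
check_trajectory X Y X.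
Qed.

Lemma iter_whirling_nat (k x y z : nat) : x <= y -> z <= y -> y <= k ->
  iter k.+2 (whirling_nat k) (x, y, z) = (z, y, x).
Proof.
wlog le_zx : x z / z <= x => [WH|] le_xy le_zy le_yk.
  case: (leqP z x) => [|/ltnW] le; first exact: WH.
  by rewrite -[(x, y, z)]/(swap_leaves (z, y, x)) iter_whirling_nat_swap WH.
case: (ltngtP z x) le_zx => // [lt_zx|->] _;
  case: (ltngtP x y) le_xy => // [lt_xy|eq_xy] _.
- exact: iter_whirling_nat_lt_lt.
- by rewrite eq_xy; apply: iter_whirling_nat_lt_eq => //; rewrite -eq_xy.
- exact: iter_whirling_nat_eq_lt.
- by rewrite eq_xy; apply: iter_whirling_nat_eq_eq.
Qed.

Theorem theorem3p15 (k : nat) (hk : 1 <= k) (x y z : 'I_k.+1)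
    (hF : in_F (triple x y z)) :
  val (iter k.+2 (@whirling k) (exist _ (triple x y z) hF)) = triple z y x.
Proof.
apply: nat_triple_inj; rewrite nat_triple_iter_whirling.
have := hF; rewrite /in_F /nat_triple /= !ffunE => /andP[le_xy le_zy].
by apply: iter_whirling_nat; rewrite // -ltnS ltn_ord.
Qed.
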